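(* Suppose that $f:\mathbb{R}\to\mathbb{R}$ is locally Lipschitz and satisfies the dissipative condition $$|f(x)|\le \eta|x|+K\quad\text{for all }x\in\mathbb{R},$$ with $\eta\|J\|_{L^1(\mathbb{R}^N)}\|\rho\|_\infty<1$. Then, if $\eta\|J\|_{L^1(\mathbb{R}^N)}\|\rho\|_\infty<\delta<1$, the ball in $C_b(\mathbb{R}^N)$ centered at the origin with radius $$R=\frac{\|J\|_{L^1(\mathbb{R}^N)}\|\rho\|_\infty K+\|h\|_\infty}{\delta-\|J\|_{L^1(\mathbb{R}^N)}\|\rho\|_\infty\,\eta}$$ is an absorbing set for the flow $T(t)$ generated in $C_b(\mathbb{R}^N)$ by $$\frac{\partial u(x,t)}{\partial t}+u(x,t)=\int_{\mathbb{R}^N}J(x-y)f(u(y,t))\rho(y)\,dy+h(x).$$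
   Context: Standing assumptions: $J:\mathbb{R}^N\to\mathbb{R}$ is non-negative and integrable; $\rho:\mathbb{R}^N\to\mathbb{R}$ is a symmetric, non-negative, bounded weight function with $\int_{\mathbb{R}^N}\rho(x)\,dx<\infty$; $h:\mathbb{R}^N\to\mathbb{R}$ is bounded and continuous. $C_b(\mathbb{R}^N)$ is the space of bounded continuous functions $u:\mathbb{R}^N\to\mathbb{R}$ with norm $\|u\|_\infty=\sup_{x}|u(x)|$. The equation is regarded as an ordinary differential equation $\dot u=-u+J*_\rho(f\circ u)+h$ in $C_b(\mathbb{R}^N)$, where $(J*_\rho v)(x)=\int_{\mathbb{R}^N}J(x-y)v(y)\rho(y)\,dy$; $T(t)u_0=u(\cdot,t)$, $t\ge 0$, is the solution with $u(\cdot,0)=u_0$. A set $\mathcal{B}\subset C_b(\mathbb{R}^N)$ is an absorbing set for $T(t)$ if for every bounded set $C\subset C_b(\mathbb{R}^N)$ there is $t_1=t_1(C)>0$ such that $T(t)C\subset\mathcal{B}$ for all $t\ge t_1$.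
   Formalization: The radius R is assumed positive; for R = 0 the claim fails (J = 0, f = 0, h = 0, K = 0 gives T(t)u_0 = e^{-t}u_0, which never enters the ball of radius 0 unless u_0 = 0). *)

(* Defs.v *)
From HB Require Import structures.
From mathcomp Require Import all_boot all_order all_algebra.
From mathcomp Require Import all_classical all_reals all_analysis.
Set Implicit Arguments.
Unset Strict Implicit.
Unset Printing Implicit Defensive.
Import Order.TTheory GRing.Theory Num.Theory.
Import numFieldNormedType.Exports.
Local Open Scope classical_set_scope.
Local Open Scope ring_scope.

(* Euclidean space of dimension N = n.+1 >= 1 is 'rV[R]_n.+1.  The library
   norm on it is the max norm, which induces the usual topology. *)

(* Lebesgue outer measure: countable covers by half-open boxes ]a, b].
   Caratheodory's construction then gives the complete Lebesgue measure on the
   Lebesgue sigma-algebra. *)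
Section lebesgue_outer.
Context (R : realType) (n : nat).
Local Notation V := 'rV[R]_n.+1.

Definition box (ab : V * V) : set V :=
  [set x | forall i, ab.1 ord0 i < x ord0 i <= ab.2 ord0 i].

Definition box_volume (ab : V * V) : R :=
  \prod_(i < n.+1) Num.max 0 (ab.2 ord0 i - ab.1 ord0 i).

Definition lebesgue_outer (A : set V) : \bar R :=
  ereal_inf [set (\sum_(k <oo) (box_volume (B k))%:E)%E |
             B in [set B : nat -> V * V | A `<=` \bigcup_k box (B k)]].

Lemma box_volume_ge0 ab : 0 <= box_volume ab.
Proof. by apply: prodr_ge0 => i _; rewrite le_max lexx. Qed.

Local Open Scope ereal_scope.

Let vol_ge0 ab : 0 <= (box_volume ab)%:E.
Proof. by rewrite lee_fin box_volume_ge0. Qed.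

Let lebesgue_outer_ge0 A : 0 <= lebesgue_outer A.
Proof. by apply: le_ereal_inf_tmp => _ [B _ <-]; exact: nneseries_ge0. Qed.

Let lebesgue_outer0 : lebesgue_outer set0 = 0.
Proof.
apply/eqP; rewrite eq_le lebesgue_outer_ge0 andbT.
apply: ereal_inf_lbound; exists (fun=> (0%R, 0%R)); first by move=> x [].
apply: eseries0 => k _ _; congr EFin.
by rewrite /box_volume big_ord_recl !mxE subrr maxxx mul0r.
Qed.

Let le_lebesgue_outer : {homo lebesgue_outer : A B / A `<=` B >-> A <= B}.
Proof.
move=> A B AB; apply/ereal_inf_le_tmp => _ [C BC <-].
by exists C => //; exact: subset_trans AB BC.
Qed.

Let lebesgue_outer_sigma_subadditive : sigma_subadditive lebesgue_outer.
Proof.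
move=> A; have [[i ioo]|] := pselect (exists i, lebesgue_outer (A i) = +oo).
  by rewrite (eseries_pinfty _ _ ioo) ?leey// => k _;
    rewrite -ltNye (lt_le_trans _ (lebesgue_outer_ge0 _)).
rewrite -forallNE => Aoo.
suff add2e (e : {posnum R}) : lebesgue_outer (\bigcup_k A k) <=
    \sum_(i <oo) lebesgue_outer (A i) + e%:num%:E.
  by apply/lee_addgt0Pr => _/posnumP[].
rewrite (le_trans _ (epsilon_trick _ _ _))//.
pose P k (B : nat -> V * V) := A k `<=` \bigcup_j box (B j) /\
  \sum_(j <oo) (box_volume (B j))%:E <=
    lebesgue_outer (A k) + (e%:num / (2 ^ k.+1)%:R)%:E.
have [G PG] : {G : nat -> nat -> V * V & forall k, P k (G k)}.
  apply: (@choice _ _ P) => k; rewrite /P /lebesgue_outer.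
  set S := (X in ereal_inf X).
  have Sfin : ereal_inf S \is a fin_num.
    by rewrite ge0_fin_numE ?lebesgue_outer_ge0// ltey; apply/eqP/Aoo.
  have ek : (0 < e%:num / (2 ^ k.+1)%:R)%R by [].
  have [x [B AB <-] /ltW xS] := lb_ereal_inf_adherent ek Sfin.
  by exists B.
pose vG ij := (box_volume (uncurry G ij))%:E.
have vG_ge0 ij : 0 <= vG ij by exact: vol_ge0.
apply: (@le_trans _ _ (\esum_(ij in setT) vG ij)).
  apply: ereal_inf_lbound => /=.
  have /card_esym/ppcard_eqP[f] := card_nat2.
  exists (uncurry G \o f).
    move=> t [i _ /(PG i).1[j _ Bijt]].
    by exists (f^-1%FUN (i, j)) => //=; rewrite invK ?inE.
  rewrite -(esum_pred_image vG _ xpredT) ?[fun=> _]set_true//.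
  by rewrite image_eq.
rewrite (_ : esum _ _ = \sum_(i <oo) \sum_(j <oo) vG (i, j)); last first.
  pose J : nat -> set (nat * nat) := fun i => [set (i, j) | j in setT].
  rewrite (_ : setT = \bigcup_k J k); last first.
    by rewrite predeqE => -[a b]; split => // _; exists a => //; exists b.
  rewrite esum_bigcupT /=; last 2 first.
    - apply/trivIsetP => i j _ _ ij.
      rewrite predeqE => -[a b] /=; split => //= -[] [_] _ [<-{a} _].
      by move=> [m' _] [] /esym/eqP; rewrite (negbTE ij).
    - by move=> *; exact: vG_ge0.
  rewrite -(image_id [set: nat]) -fun_true esum_pred_image//; last first.
    by move=> i _; exact: esum_ge0.
  apply: eq_eseriesr => /= j _.
  rewrite -(esum_pred_image vG (pair j) predT)//=; last first.
    by move=> ? ? _ _; exact: (@can_inj _ _ _ snd).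
  by congr esum; rewrite predeqE => -[a b]; split; move=> [i _ <-]; exists i.
apply: lee_lim.
- by apply: is_cvg_nneseries => i *; exact: nneseries_ge0.
- by apply: is_cvg_nneseries => i *; apply: adde_ge0.
- by near=> i; apply: lee_sum => k _; exact: (PG k).2.
Unshelve. all: by end_near. Qed.

HB.instance Definition _ := isOuterMeasure.Build R V lebesgue_outer
  lebesgue_outer0 lebesgue_outer_ge0 le_lebesgue_outer
  lebesgue_outer_sigma_subadditive.

Definition lebesgueRn : set (caratheodory_type lebesgue_outer) -> \bar R :=
  lebesgue_outer.

HB.instance Definition _ := isMeasure.Build _ _ _ lebesgueRn
  (@caratheodory_measure0 R V lebesgue_outer)
  (@caratheodory_measure_ge0 R V lebesgue_outer)
  (@caratheodory_measure_sigma_additive R V lebesgue_outer).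

End lebesgue_outer.
Arguments lebesgueRn {R n}.

Definition sup_norm (R : realType) (T : Type) (u : T -> R) : R :=
  sup (range (fun x => `|u x|)).

Definition L1_norm (R : realType) (n : nat) (u : 'rV[R]_n.+1 -> R) : R :=
  fine ('N[lebesgueRn]_1%:E [EFin \o u])%E.

Section bounded_continuous.
Context (R : realType) (n : nat).
Local Notation V := 'rV[R]_n.+1.

Definition bounded_continuous : {pred (V -> R)} :=
  [pred u | `[< continuous u /\ bounded_fun u >]].

Record Cb := MkCb { Cb_fun :> V -> R; _ : Cb_fun \in bounded_continuous }.

HB.instance Definition _ := [isSub for Cb_fun].
HB.instance Definition _ := [Choice of Cb by <:].

Lemma bounded_funP (u : V -> R) :
  bounded_fun u <-> exists M, forall x, `|u x| <= M.
Proof.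
have PF : ProperFilter (globally [set: V]).
  exact: (@globally_properfilter _ _ 0).
rewrite /= ex_bound; split=> -[M uM]; exists M => x *; exact: uM.
Qed.

Lemma Cb_submod_closed : submod_closed bounded_continuous.
Proof.
split=> [|a u v].
  by apply/asboolP; split; [exact: cst_continuous|exact: bounded_cst].
move=> /asboolP[cu bu] /asboolP[cv bv]; apply/asboolP; split.
  move=> x; apply: (@cvgD _ R^o _ (nbhs x) _ (a \*: (u : V -> R^o)) v) (cv x).
  exact: cvgZl_tmp (cu x).
apply/bounded_funP.
have [[M uM] [M' vM]] := ((bounded_funP u).1 bu, (bounded_funP v).1 bv).
exists (`|a| * M + M') => x.
rewrite (le_trans (ler_normD _ _))// lerD ?vM//.
by rewrite normrM ler_wpM2l// uM.
Qed.

HB.instance Definition _ := GRing.isSubmodClosed.Build R (V -> R)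
  bounded_continuous Cb_submod_closed.
HB.instance Definition _ := [SubChoice_isSubLmodule of Cb by <:].

Lemma Cb_has_sup (u : Cb) : has_sup (range (fun x => `|u x|)).
Proof.
split; first by exists `|u 0|, 0.
have /asboolP[_ /bounded_funP[M uM]] := valP u.
by exists M => _ [x _ <-]; exact: uM.
Qed.

Lemma Cb_le_norm (u : Cb) x : `|u x| <= sup_norm u.
Proof. by apply: (ub_le_sup (Cb_has_sup u).2); exists x. Qed.

Lemma Cb_norm_le (u : Cb) M : (forall x, `|u x| <= M) -> sup_norm u <= M.
Proof. by move=> uM; apply: (ge_sup (Cb_has_sup u).1) => _ [x _ <-]. Qed.

Let Cb_normD (u v : Cb) : sup_norm (u + v : Cb) <= sup_norm u + sup_norm v.
Proof.
by apply: Cb_norm_le => x; rewrite (le_trans (ler_normD _ _))// lerD ?Cb_le_norm.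
Qed.

Let Cb_normZ (a : R) (u : Cb) : sup_norm (a *: u : Cb) = `|a| * sup_norm u.
Proof.
have le b (v : Cb) : sup_norm (b *: v : Cb) <= `|b| * sup_norm v.
  by apply: Cb_norm_le => x; rewrite normrM ler_wpM2l ?Cb_le_norm.
apply/le_anti/andP; split; first exact: le.
have [->|a0] := eqVneq a 0.
  by rewrite normr0 mul0r (le_trans _ (Cb_le_norm (0 *: u) 0)).
rewrite mulrC -ler_pdivlMr ?normr_gt0// mulrC -normfV.
by rewrite -[in leLHS](scalerK a0 u) le.
Qed.

Let Cb_norm_eq0 (u : Cb) : sup_norm u = 0 -> u = 0.
Proof.
move=> u0; apply/val_inj/funext => x; apply/eqP.
by rewrite -normr_le0 -u0 Cb_le_norm.
Qed.

HB.instance Definition _ := @Lmodule_isNormed.Build R Cb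
  (fun u : Cb => sup_norm u) Cb_normD Cb_normZ Cb_norm_eq0.

End bounded_continuous.

Definition locally_lipschitz (R : realType) (f : R -> R) : Prop :=
  forall x : R, exists2 U, nbhs x U & [lipschitz f y | y in U].

Section flow.
Context (R : realType) (n : nat).
Local Notation V := 'rV[R]_n.+1.
Local Notation C := (Cb R n).

Definition conv_weight (J rho v : V -> R) (x : V) : R :=
  \int[lebesgueRn]_y (J (x - y) * v y * rho y).

(* The derivative is that of a curve in the normed space C_b, i.e. for the sup
   norm.  At t = 0 only continuity is asked: the one-sided derivative there then
   exists and satisfies the same equation. *)
Definition is_solution (J rho : V -> R) (f : R -> R) (h : C) (u : R -> C) :=
  {within `[0, +oo[, continuous u} /\
  forall t, 0 < t -> derivable u t 1 /\
    forall x, ('D_1 u t : C) x + u t x = conv_weight J rho (f \o u t) x + h x.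

(* Nothing is asked of T t for t < 0. *)
Definition is_flow (J rho : V -> R) (f : R -> R) (h : C) (T : R -> C -> C) :=
  forall u0, T 0 u0 = u0 /\ is_solution J rho f h (T ^~ u0).

Definition absorbing_set (T : R -> C -> C) (B : set C) :=
  forall A : set C, bounded_set A ->
    exists2 t1, 0 < t1 & forall t, t1 <= t -> T t @` A `<=` B.

End flow.

(* Main.v *)
(** Reflections [y |-> x - y] preserve Lebesgue measure, so the forcing term
    [F = J *_rho (f o u) + h] satisfies [|F| <= a |u| + b] with
    [a = |J|_1 |rho|_oo eta] and [b = |J|_1 |rho|_oo K + |h|_oo].  Any
    [phi t = M exp(-(1-a)t) + b/(1-a)] solves [phi' + phi = a phi + b], and at
    the first time [|u|] meets [phi] the pointwise equations would give
    [|u| < phi]; hence [|u| < phi] for all time if [|u 0| < M].  Since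
    [delta < 1], the limit [b/(1-a)] is strictly below the radius
    [b/(delta-a)]. *)
Require Import Defs.
From HB Require Import structures.
From mathcomp Require Import all_boot all_order all_algebra.
From mathcomp Require Import all_classical all_reals all_analysis.
From mathcomp Require Import measurable_realfun ring lra.
Set Implicit Arguments.
Unset Strict Implicit.
Unset Printing Implicit Defensive.
Import Order.TTheory GRing.Theory Num.Theory.
Import numFieldNormedType.Exports.
Local Open Scope classical_set_scope.
Local Open Scope ring_scope.

(** * Reflection invariance of Lebesgue measure *)

Lemma cvg_prod (R : numFieldType) (T I : Type) (F : set_system T) (FF : Filter F)
  (r : seq I) (f : I -> T -> R) (l : I -> R) :
  (forall i, f i t @[t --> F] --> l i) ->
  \prod_(i <- r) f i t @[t --> F] --> \prod_(i <- r) l i.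
Proof.
move=> fl; elim: r => [|i r ih].
  by rewrite big_nil; under eq_fun do rewrite big_nil; exact: cvg_cst.
by rewrite big_cons; under eq_fun do rewrite big_cons; exact: cvgM.
Qed.

Section reflection.
Context (R : realType) (n : nat).
Local Notation V := 'rV[R]_n.+1.

(** The volume is a finite product of continuous functions of the lower corner, so a small enough
    shift costs at most [e]. This is the slack spent on covering reflected boxes. *)
Lemma box_volume_enlarge (ab : V * V) (e : R) : 0 < e ->
  exists2 d, 0 < d & box_volume (ab.1 - const_mx d, ab.2) <= box_volume ab + e.
Proof.
move=> e0.
have : box_volume (ab.1 - const_mx d, ab.2) @[d --> (0 : R)] --> box_volume ab.
  apply: cvg_prod => i.
  under eq_fun do rewrite /= !mxE opprB addrA -addrAC.
  set c := ab.2 ord0 i - ab.1 ord0 i.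
  have -> : Num.max 0 c = Num.max 0 (c + 0) by rewrite addr0.
  apply: (@continuous_max _ _ (cst 0) (fun d => c + d) 0).
    exact: cvg_cst.
  apply: cvgD; [exact: cvg_cst|exact: cvg_id].
move=> /cvgrPdist_le/(_ _ e0)/nbhs_ballP[d /= d0 bd].
exists (d / 2); first by rewrite divr_gt0.
have /= : `|box_volume ab - box_volume (ab.1 - const_mx (d / 2), ab.2)| <= e.
  apply: bd; rewrite /ball/= sub0r normrN gtr0_norm ?divr_gt0//.
  by rewrite ltr_pdivrMr// ltr_pMr// ltr1n.
rewrite ler_norml => /andP[+ _]; lra.
Qed.

(* A reflected box is half-open on the wrong side, so it is covered by a box
   slightly enlarged at its lower corner. *)
Lemma lebesgue_outer_reflect_le (c : V) (A : set V) :
  (lebesgue_outer [set y | A (c - y)%R] <= lebesgue_outer A)%E.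
Proof.
apply: le_ereal_inf_tmp => _ [B AB <-].
apply/lee_addgt0Pr => e e0.
have /choice[d dP] k : exists d : R, 0 < d /\
    box_volume ((B k).1 - const_mx d, (B k).2) <=
    box_volume (B k) + e / (2 ^ k.+1)%:R.
  have [|d d0 dB] := @box_volume_enlarge (B k) (e / (2 ^ k.+1)%:R).
    by rewrite divr_gt0// ltr0n expn_gt0.
  by exists d.
apply: le_trans (epsilon_trick _ _ (ltW e0)); last first.
  by move=> k; rewrite lee_fin box_volume_ge0.
pose B' k := (c - (B k).2 - const_mx (d k), c - (B k).1).
apply: (@le_trans _ _ (\sum_(k <oo) (box_volume (B' k))%:E)%E).
  apply: ereal_inf_lbound; exists B' => //.
  move=> y /AB[k _ Bky]; exists k => // i.
  have /andP[lt le] := Bky i; rewrite !mxE in lt le *.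
  have := (dP k).1.
  move=> d0; apply/andP; split; lra.
apply: lee_nneseries => k _ /=; first by rewrite lee_fin box_volume_ge0.
rewrite -EFinD lee_fin; apply: le_trans (dP k).2.
rewrite le_eqVlt; apply/orP; left; apply/eqP; apply: eq_bigr => i _.
by rewrite !mxE; congr Num.max; ring.
Qed.

(** A reflection is an involution, so the inequality applied to the reflected set yields the reverse
    one. *)
Lemma lebesgue_outer_reflect (c : V) (A : set V) :
  lebesgue_outer [set y | A (c - y)%R] = lebesgue_outer A.
Proof.
apply/le_anti/andP; split; first exact: lebesgue_outer_reflect_le.
rewrite -[in leLHS](_ : [set y | [set z | A (c - z)%R] (c - y)] = A).
  exact: lebesgue_outer_reflect_le.
by apply/funext => y /=; rewrite opprB addrC subrK.
Qed.

Local Notation X := (caratheodory_type (@lebesgue_outer R n)).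

(** Caratheodory's splitting condition involves the outer measure alone; reflecting the test set [B]
    reduces the condition for the reflected set to the one for [A]. *)
Lemma measurable_reflect (c : V) :
  measurable_fun setT (fun y : X => c - y : X).
Proof.
move=> _ A mA; rewrite setTI.
have {}mA : (@lebesgue_outer R n).-caratheodory A := mA.
change ((@lebesgue_outer R n).-caratheodory [set y | A (c - y)]) => B.
rewrite -(lebesgue_outer_reflect c B) (mA [set y | B (c - y)]).
rewrite -(lebesgue_outer_reflect c (B `&` _)).
rewrite -(lebesgue_outer_reflect c (B `&` ~` _)).
have e (D : set V) :
    [set y | (B `&` [set z | D (c - z)]) (c - y)] = [set y | B (c - y)] `&` D.
  by apply/funext => y /=; rewrite /setI/= subKr.
by rewrite e (e (~` A)).
Qed.

Lemma ge0_integral_reflect (c : V) (f : V -> \bar R) :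
  measurable_fun [set: X] f -> (forall y, 0 <= f y)%E ->
  (\int[lebesgueRn]_y f (c - y)%R = \int[lebesgueRn]_y f y)%E.
Proof.
move=> mf f0.
have pushE : pushforward (@lebesgueRn R n) (fun y : X => c - y : X) = lebesgueRn.
  by apply/funext => A; exact: lebesgue_outer_reflect.
have := @ge0_integral_pushforward _ _ X X R _ (measurable_reflect c)
  (@lebesgueRn R n) setT f measurableT mf (fun y _ => f0 y).
by rewrite preimage_setT => <-; rewrite pushE.
Qed.

End reflection.

(** * Pointwise bound on the weighted convolution *)

Import HBNNSimple.

(* No measurability of [f] is assumed: the integral is a difference of suprema
   over simple functions, which are monotone in any case. *)
Lemma Rintegral_bound d (T : measurableType d) (R : realType)
  (mu : {measure set T -> \bar R}) (f g : T -> R) (M : R) :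
  (forall x, `|f x| <= g x) -> (\int[mu]_x (g x)%:E <= M%:E)%E ->
  `|\int[mu]_x f x| <= M.
Proof.
move=> fg gM.
have bnd (k : T -> \bar R) : (forall x, 0 <= k x <= (g x)%:E)%E ->
    (0 <= \int[mu]_x k x <= M%:E)%E.
  move=> kg.
  have k0 x : (0 <= k x)%E by have /andP[] := kg x.
  have g0 x : (0 <= (g x)%:E)%E by have /andP[] := kg x; exact: le_trans.
  rewrite integral_ge0//= (le_trans _ gM)// !ge0_integralTE//.
  apply: ereal_sup_le => _ [s sk <-].
  by exists s => // x; apply: le_trans (sk x) _; have /andP[] := kg x.
(* The positive and negative parts of [f] both lie below [g], so each integrates to a value in
   [0, M] and the difference lies in [-M, M]. *)
rewrite /Rintegral integralE.
set p := (\int[mu]_x _)%E; set q := (\int[mu]_x _)%E.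
have /andP[p0 pM] : (0 <= p <= M%:E)%E.
  apply: bnd => x; rewrite funepos_ge0/= funeposE -EFin_max lee_fin.
  by rewrite ge_max (le_trans (ler_norm _))// (le_trans _ (fg x)).
have /andP[q0 qM] : (0 <= q <= M%:E)%E.
  apply: bnd => x; rewrite funeneg_ge0/= funenegE -EFinN -EFin_max lee_fin.
  by rewrite ge_max (le_trans (ler_norm _)) ?normrN// (le_trans _ (fg x)).
move: p q p0 pM q0 qM => [p| |] [q| |]//; rewrite !lee_fin => p0 pM q0 qM.
by rewrite /= ler_norml; apply/andP; split; lra.
Qed.

Lemma le_sup_norm (R : realType) (n : nat) (u : 'rV[R]_n.+1 -> R) x :
  bounded_fun u -> `|u x| <= sup_norm u.
Proof.
move=> /Defs.bounded_funP[C uC]; apply: ub_le_sup; last by exists x.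
by exists C => _ [y _ <-].
Qed.

(** The integrand is dominated by [sup_norm rho * M * J (x - y)], and reflection invariance turns
    the integral of [J (x - y)] in [y] into the L1 norm of [J], whatever [x] is. *)
Lemma conv_weight_bound (R : realType) (n : nat) (J rho v : 'rV[R]_n.+1 -> R)
  (M : R) x :
  (forall y, 0 <= J y) -> lebesgueRn.-integrable setT (EFin \o J) ->
  (forall y, 0 <= rho y) -> bounded_fun rho -> (forall y, `|v y| <= M) ->
  `|conv_weight J rho v x| <= L1_norm J * sup_norm rho * M.
Proof.
move=> J0 iJ rho0 brho vM.
have rho_sup y : rho y <= sup_norm rho.
  exact: le_trans (ler_norm _) (le_sup_norm y brho).
have S0 : 0 <= sup_norm rho * M.
  rewrite mulr_ge0//; first exact: le_trans (rho0 0) (rho_sup 0).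
  exact: le_trans (normr_ge0 _) (vM 0).
have mJ := measurable_int _ iJ.
rewrite /conv_weight.
apply: (@Rintegral_bound _ (caratheodory_type (@lebesgue_outer R n)) R lebesgueRn
  (fun y : 'rV[R]_n.+1 => J (x - y) * v y * rho y)
  (fun y : 'rV[R]_n.+1 => sup_norm rho * M * J (x - y))).
  move=> y; rewrite !normrM (ger0_norm (J0 _)) (ger0_norm (rho0 _)).
  have := rho_sup y; have := vM y; have := rho0 y; have := J0 (x - y).
  set a := J _; set s := sup_norm rho; set p := `|v y| => a0 r0 pM rs.
  have p0 : 0 <= p := normr_ge0 _.
  by rewrite -mulrA [leRHS]mulrC ler_wpM2l// [s * M]mulrC ler_pM.
under eq_integral do rewrite EFinM.
pose g (y : 'rV[R]_n.+1) := ((sup_norm rho * M)%:E * (J y)%:E)%E.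
have mg : measurable_fun [set: caratheodory_type (@lebesgue_outer R n)] g.
  exact: measurable_funeM.
rewrite (@ge0_integral_reflect R n x g mg); last first.
  by move=> y; rewrite mule_ge0// lee_fin.
rewrite ge0_integralZl//=; last by move=> y _; rewrite lee_fin.
rewrite /L1_norm Lnorm1.
have -> : (\int[lebesgueRn]_y `|(EFin \o J) y| = \int[lebesgueRn]_y (J y)%:E)%E.
  by apply: eq_integral => y _ /=; rewrite ger0_norm.
have /fineK <- : (\int[lebesgueRn]_y (J y)%:E)%E \is a fin_num.
  exact: (integrable_fin_num measurableT iJ).
by rewrite -EFinM lee_fin; lra.
Qed.

(** * Barrier estimate for solutions *)

Section evaluation.
Context (R : realType) (n : nat).
Local Notation V := 'rV[R]_n.+1.
Local Notation C := (Cb R n).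

Lemma cvg_Cb_eval T (F : set_system T) (FF : Filter F) (u : T -> C) (l : C) x :
  u t @[t --> F] --> l -> u t x @[t --> F] --> l x.
Proof.
move=> ul; apply/cvgrPdist_le => e e0.
move/cvgrPdist_le : ul => /(_ e e0); apply: filterS => t.
exact: le_trans (Cb_le_norm (l - u t) x).
Qed.

(** Evaluation at [x] is linear and 1-Lipschitz for the sup norm, so it commutes with the limit of
    difference quotients; the equation in C_b becomes a scalar one for each [x]. *)
Lemma is_derive_Cb_eval (u : R -> C) t x : derivable u t 1 ->
  is_derive t 1 (fun s => u s x) (('D_1 u t : C) x).
Proof.
move=> du.
have cu : h^-1 *: (u (h *: 1 + t) x - u t x) @[h --> 0^'] --> ('D_1 u t : C) x.
  exact: (@cvg_Cb_eval _ _ _ (fun h : R => h^-1 *: (u (h *: 1 + t) - u t)) _ x du).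
apply: DeriveDef; first by apply/cvg_ex; exists (('D_1 u t : C) x).
exact/cvg_lim.
Qed.

End evaluation.

Lemma solution_bound (R : realType) (n : nat) (J rho : 'rV[R]_n.+1 -> R)
  (f : R -> R) (h : Cb R n) (u : R -> Cb R n) (a b M : R) :
  0 <= a -> a < 1 ->
  (forall (v : Cb R n) x, `|conv_weight J rho (f \o v) x + h x| <= a * `|v| + b) ->
  is_solution J rho f h u -> 0 <= b -> `|u 0| < M ->
  forall t, 0 <= t -> `|u t| < M * expR (- (1 - a) * t) + b / (1 - a).
Proof.
move=> a0 a1 Fb [cu du] b0 uM.
pose phi (t : R) : R := M * expR (- (1 - a) * t) + b / (1 - a).
have dphi (t : R) : is_derive t 1 phi (a * phi t + b - phi t).
  rewrite /phi; apply: is_derive_eq; rewrite /GRing.scale/=; field.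
  by rewrite gt_eqF// subr_gt0.
have cphi : continuous phi.
  by move=> t; apply/differentiable_continuous/derivable1_diffP/ex_derive.
have phi0 : `|u 0| < phi 0.
  by rewrite /phi mulr0 expR0 mulr1 ltr_wpDr// divr_ge0// subr_ge0 ltW.
have step (t : R) : 0 <= t -> (forall s, 0 < s < t -> `|u s| <= phi s) ->
    `|u t| < phi t.
  move=> t0 ub.
  (* [sg] stands for 1 or -1, treating both signs of [u t x] at once. The lower bound does not
     depend on [x], so strictness survives the supremum over [x]. *)
  have aux (sg : R) x : `|sg| = 1 ->
      phi 0 - `|u 0| <= expR t * (phi t - sg * u t x).
    move=> sg1; pose w (s : R) : R := expR s * (phi s - sg * u s x).
    have dw (s : R) : 0 < s -> is_derive s 1 w
        (expR s * (a * phi s + b - sg * (conv_weight J rho (f \o u s) x + h x))).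
      move=> s0; have [dus eqs] := du s s0.
      have ? := is_derive_Cb_eval x dus.
      rewrite /w; apply: is_derive_eq; rewrite -(eqs x) /GRing.scale/=; ring.
    (* [exp(s) (phi s -+ u s x)] has derivative [exp(s) (a phi s + b -+ F)] with
       [|F| <= a |u s| + b], hence is nondecreasing as long as [|u| <= phi]. *)
    have w0t : w 0 <= w t.
      apply: (@ger0_derive1_le_cc _ w 0 t); last exact: t0.
      - by move=> s; rewrite in_itv/= => /andP[s0 _];
          exact: (@ex_derive _ _ _ _ _ _ _ (dw s s0)).
      - move=> s st; have [s0 lt_st] : 0 < s /\ s < t.
          by move: st; rewrite in_itv/= => /andP.
        rewrite derive1E (@derive_val _ _ _ _ _ _ _ (dw s s0)).
        rewrite mulr_ge0 ?expR_ge0// subr_ge0 (le_trans (ler_norm _))//.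
        rewrite normrM sg1 mul1r (le_trans (Fb _ _))// lerD2r ler_wpM2l//.
        by apply: ub; rewrite s0.
      - move=> s; apply: cvgM.
          exact/(@continuous_subspaceT _ _ `[0, t])/continuous_expR.
        apply: cvgB; first exact: (@continuous_subspaceT _ _ `[0, t]).
        apply: cvgM; first exact: cvg_cst.
        apply: cvg_Cb_eval; apply: (continuous_subspaceW _ cu).
        by move=> z /=; rewrite !in_itv/= => /andP[->].
      - by rewrite in_itv/= lexx.
      - by rewrite in_itv/= t0 lexx.
    apply: le_trans w0t; rewrite /w expR0 mul1r lerB//.
    rewrite (le_trans (ler_norm _))// normrM sg1 mul1r.
    exact: Cb_le_norm.
  apply: (@le_lt_trans _ _ (phi t - (phi 0 - `|u 0|) * expR (- t))); last first.
    by rewrite ltrBlDr ltrDl mulr_gt0 ?expR_gt0// subr_gt0.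
  apply: Cb_norm_le => x.
  have bnd sg : `|sg| = 1 -> sg * u t x <= phi t - (phi 0 - `|u 0|) * expR (- t).
    move=> sg1; rewrite lerBrDr -lerBrDl expRN ler_pdivrMr ?expR_gt0// mulrC.
    exact: aux.
  rewrite ler_norml -[u t x]mul1r bnd ?normr1// andbT.
  by rewrite lerNl -mulN1r mul1r bnd// normrN1.
move=> t t0; rewrite ltNge; apply/negP => tE.
(* No time before [inf E] lies in [E], so [step] makes the inequality strict at [inf E]; continuity
   keeps it strict on some [inf E, inf E + e[, which must contain a point of [E]: a
   contradiction. *)
pose E := [set s | 0 <= s /\ phi s <= `|u s|].
have infE : has_inf E by split; [exists t|exists 0 => s []].
have E0 : 0 <= inf E by apply: lb_le_inf; [exists t|move=> s []].
have inf_lt : `|u (inf E)| < phi (inf E).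
  apply: step => // s /andP[s0 sE]; rewrite leNgt; apply/negP => us.
  by move: sE; rewrite ltNge ge_inf//; [exact: infE.2|split; exact: ltW].
have : phi s - `|u s| @[s --> within `[0, +oo[ (nbhs (inf E))] -->
    phi (inf E) - `|u (inf E)|.
  apply: cvgB; first exact: cvg_within_filter (cphi _).
  apply: cvg_norm; move/subspace_continuousP : cu; apply.
  by rewrite /= in_itv/= E0.
move=> /cvgr_gt/(_ 0); rewrite subr_gt0 => /(_ inf_lt).
move=> /nbhs_ballP[e /= e0 he].
have [s [s0 sE] se] := inf_adherent e0 infE.
have inf_s : inf E <= s by apply: ge_inf; [exact: infE.2|].
have /(he s) : ball (inf E) e s.
  by rewrite /ball/= ler0_norm ?subr_le0// opprB ltrBlDl.
by rewrite /= in_itv/= s0 => /(_ isT); rewrite subr_gt0 ltNge sE.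
Qed.

(** * Entry into the ball *)

Theorem lemma2p6 (R : realType) (n : nat) (J rho : 'rV[R]_n.+1 -> R)
  (h : Cb R n) (f : R -> R) (eta K delta : R) (T : R -> Cb R n -> Cb R n)
  (J_ge0 : forall x, 0 <= J x)
  (J_int : lebesgueRn.-integrable setT (EFin \o J))
  (rho_sym : forall x, rho (- x) = rho x)
  (rho_ge0 : forall x, 0 <= rho x)
  (rho_bnd : bounded_fun rho)
  (rho_int : lebesgueRn.-integrable setT (EFin \o rho))
  (f_lip : locally_lipschitz f)
  (f_diss : forall x, `|f x| <= eta * `|x| + K)
  (eta_lt1 : eta * L1_norm J * sup_norm rho < 1)
  (T_flow : is_flow J rho f h T)
  (delta_gt : eta * L1_norm J * sup_norm rho < delta)
  (delta_lt1 : delta < 1) :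
  let r := (L1_norm J * sup_norm rho * K + sup_norm h)
           / (delta - L1_norm J * sup_norm rho * eta) in
  0 < r -> absorbing_set T (ball (0 : Cb R n) r).
Proof.
move=> r r_gt0 A /pinfty_ex_gt0[M M_gt0 AM].
have J1_ge0 : 0 <= L1_norm J by exact/fine_ge0/Lnorm_ge0.
have rho_sup_ge0 : 0 <= sup_norm rho.
  exact: le_trans (normr_ge0 _) (le_sup_norm 0 rho_bnd).
have K_ge0 : 0 <= K.
  by have := f_diss 0; rewrite normr0 mulr0 add0r; exact: le_trans.
have eta_ge0 : 0 <= eta.
  rewrite leNgt; apply/negP => eta_lt0.
  (* For negative [eta], the growth condition at this point would bound an absolute value by -1. *)
  have x_ge0 : 0 <= (K + 1) / - eta.
    by rewrite divr_ge0 ?addr_ge0// oppr_ge0 ltW.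
  have := le_trans (normr_ge0 _) (f_diss ((K + 1) / - eta)).
  rewrite (ger0_norm x_ge0).
  have -> : eta * ((K + 1) / - eta) = - (K + 1).
    by field; rewrite ?oppr_eq0 lt_eqF.
  lra.
pose a := L1_norm J * sup_norm rho * eta.
pose b := L1_norm J * sup_norm rho * K + sup_norm h.
have rE : r = b / (delta - a) by [].
have aE : eta * L1_norm J * sup_norm rho = a by rewrite /a; ring.
rewrite aE in delta_gt.
have a_ge0 : 0 <= a by rewrite !mulr_ge0.
have a_lt1 : a < 1 by exact: lt_trans delta_lt1.
have b_gt0 : 0 < b by move: r_gt0; rewrite rE pmulr_lgt0// invr_gt0 subr_gt0.
have conv_bound (v : Cb R n) x :
    `|conv_weight J rho (f \o v) x + h x| <= a * `|v| + b.
  rewrite (le_trans (ler_normD _ _))// /b addrA lerD ?Cb_le_norm//.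
  have -> : a * `|v| + L1_norm J * sup_norm rho * K =
      L1_norm J * sup_norm rho * (eta * `|v| + K) by rewrite /a; ring.
  apply: conv_weight_bound => // y.
  by rewrite (le_trans (f_diss _))// lerD2r ler_wpM2l// Cb_le_norm.
(* The transient [(M + 1) * expR (- (1 - a) * t)] fits into the room between [b / (1 - a)] and [r]
   once the exponential is at most [q]. Taking [M + 1] makes the bound on the initial datum
   strict. *)
pose q := (r - b / (1 - a)) / (M + 1).
have q_gt0 : 0 < q.
  apply: divr_gt0; last exact: addr_gt0.
  rewrite subr_gt0 rE ltr_pM2l// ltf_pV2 ?posrE ?subr_gt0//.
  by rewrite ltrD2r.
(* From this time on [(1 - a) * t] is at least [q^-1], and exp(x) >= 1 + x then gives exp((1-a)t) >=
   [q^-1] without a logarithm. *)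
exists ((1 - a) * q)^-1; first by rewrite invr_gt0 mulr_gt0// subr_gt0.
move=> t t1t _ [u0 Au0 <-].
have t_ge0 : 0 <= t.
  by apply: le_trans t1t; rewrite invr_ge0 mulr_ge0// ?subr_ge0; exact: ltW.
have [Tu0 Tsol] := T_flow u0.
have u0M : `|T 0 u0| < M + 1.
  by rewrite Tu0 (le_lt_trans (AM _ Au0))// ltrDl.
have := solution_bound a_ge0 a_lt1 conv_bound Tsol (ltW b_gt0) u0M t_ge0.
rewrite -ball_normE /ball_/= sub0r normrN => /lt_le_trans; apply.
rewrite -lerBrDr mulrC -ler_pdivlMr ?addr_gt0// -/q.
rewrite mulNr expRN invf_ple ?posrE ?expR_gt0//.
apply: le_trans (expR_ge1Dx _).
have : q^-1 <= (1 - a) * t.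
  have -> : q^-1 = (1 - a) * ((1 - a) * q)^-1.
    by rewrite [in RHS]invfM mulVKf// gt_eqF// subr_gt0.
  by rewrite ler_wpM2l// subr_ge0 ltW.
lra.
Qed.
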